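(* Let $a,b$ be real numbers with $0<a<b$. Then $$\left|-\ln I(a,b)+\frac{\ln\left(a^{b}/b^{a}\right)}{2(b-a)}+\frac12\ln A(a,b)\right|\le\frac{12}{48}+\frac{7b}{48a}+\frac{5a}{48b} .$$
   Context: For $0<a<b$: $A(a,b)=\frac{a+b}{2}$ (arithmetic mean) and $I(a,b)=\frac1e\left(\frac{b^{b}}{a^{a}}\right)^{\frac{1}{b-a}}$ (identric mean). *)

(* Defs.v *)
From Stdlib Require Import Reals.
Open Scope R_scope.

Definition arith_mean (a b : R) : R := (a + b) / 2.

(* Real powers are [Rpower], which is the usual power only for a positive
   base; the means are used for 0 < a < b only. *)
Definition identric_mean (a b : R) : R :=
  / exp 1 * Rpower (Rpower b b / Rpower a a) (1 / (b - a)).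

(* Main.v *)
Require Import Defs.
From Stdlib Require Import Reals.
From Stdlib Require Import Lra Psatz.
From Coquelicot Require Import Coquelicot.
Open Scope R_scope.

(** By homogeneity everything depends on t = b/a only: with L = ln t and
    M = ln ((1 + t) / 2) the quantity in absolute value is
    E = 1 - L (2t + 1) / (2 (t - 1)) + M / 2.
    The bound E <= 1/2 follows from M <= L and L >= 1 - 1/t.  For -E, write
    L (2t + 1) / (2 (t - 1)) = L (t + 2) / (2 (t - 1)) + L / 2, bound
    L - M = ln (2t / (1 + t)) by (t - 1) / (t + 1), and bound the remaining L
    by its Padé approximant (t - 1) (t + 5) / (2 (2t + 1)).  The
    inequality for -E tends to the equality 1/2 = 1/2 as t -> 1, so these bounds
    have to be sharp there. *)

Lemma ln_le_sub_1 (x : R) : 0 < x -> ln x <= x - 1.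
Proof.
  intros hx.
  pose proof (exp_ineq1_le (ln x)) as H.
  rewrite exp_ln in H by exact hx. lra.
Qed.

Lemma ln_ge_1_sub_inv (x : R) : 0 < x -> 1 - / x <= ln x.
Proof.
  intros hx.
  pose proof (ln_le_sub_1 (/ x) (Rinv_0_lt_compat x hx)) as H.
  rewrite ln_Rinv in H by exact hx. lra.
Qed.

(** Both sides vanish at 1, and the difference has derivative [(x - 1) ^ 3 / (x * (2 * x + 1) ^ 2)],
    nonnegative for [x >= 1]. *)
Lemma ln_le_pade (t : R) :
  1 < t -> ln t <= (t - 1) * (t + 5) / (2 * (2 * t + 1)).
Proof.
  intros ht.
  destruct (MVT_cor2 (fun x => (x - 1) * (x + 5) / (2 * (2 * x + 1)) - ln x)
              (fun x => (x - 1) ^ 3 / (x * (2 * x + 1) ^ 2)) 1 t ht)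
    as [c [Hc [hc1 hct]]].
  - intros x hx. apply is_derive_Reals. auto_derive.
    + repeat split; lra.
    + field. lra.
  - rewrite ln_1 in Hc.
    assert (0 <= (c - 1) ^ 3 / (c * (2 * c + 1) ^ 2)).
    { apply Rdiv_le_0_compat.
      - apply pow_le. lra.
      - apply Rmult_lt_0_compat; [ | apply pow_lt ]; lra. }
    nra.
Qed.

Lemma reduced_bounds (t : R) (ht : 1 < t) :
  Rabs (1 - ln t * (2 * t + 1) / (2 * (t - 1)) + ln ((1 + t) / 2) / 2)
  <= 12 / 48 + 7 * t / 48 + 5 / (48 * t).
Proof.
  set (M := ln ((1 + t) / 2)).
  assert (Hsplit : ln t * (2 * t + 1) / (2 * (t - 1))
                   = ln t * ((t + 2) / (2 * (t - 1))) + ln t / 2)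
    by (field; lra).
  assert (Hcoef : 0 < (t + 2) / (2 * (t - 1)))
    by (apply Rdiv_lt_0_compat; lra).
  rewrite Hsplit. apply Rabs_le. split.
  - assert (HLM : ln t - M <= (t - 1) / (t + 1)).
    { unfold M. rewrite <- ln_div by lra.
      replace ((t - 1) / (t + 1)) with (t / ((1 + t) / 2) - 1) by (field; lra).
      apply ln_le_sub_1. apply Rdiv_lt_0_compat; lra. }
    pose proof (Rmult_le_compat_r _ _ _ (Rlt_le _ _ Hcoef) (ln_le_pade t ht)) as HL.
    replace ((t - 1) * (t + 5) / (2 * (2 * t + 1)) * ((t + 2) / (2 * (t - 1))))
      with ((t + 5) * (t + 2) / (4 * (2 * t + 1))) in HL by (field; lra).
    enough (0 <= 12 / 48 + 7 * t / 48 + 5 / (48 * t) + 1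
              - (t + 5) * (t + 2) / (4 * (2 * t + 1)) - (t - 1) / (t + 1) / 2) by lra.
    (* The factor [t - 1] records the equality at [t = 1]; the cubic is
       [t ^ 2 * (2 * t - 1) + (16 * t - 5)], a sum of positive terms. *)
    replace (12 / 48 + 7 * t / 48 + 5 / (48 * t) + 1
              - (t + 5) * (t + 2) / (4 * (2 * t + 1)) - (t - 1) / (t + 1) / 2)
      with ((t - 1) * (2 * t ^ 3 - t ^ 2 + 16 * t - 5) / (48 * t * (2 * t + 1) * (t + 1)))
      by (field; lra).
    apply Rdiv_le_0_compat.
    + apply Rmult_le_pos; nra.
    + repeat apply Rmult_lt_0_compat; lra.
  - assert (HML : M <= ln t) by (apply ln_le; lra).
    pose proof (Rmult_le_compat_r _ _ _ (Rlt_le _ _ Hcoef)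
                  (ln_ge_1_sub_inv t ltac:(lra))) as HL.
    replace ((1 - / t) * ((t + 2) / (2 * (t - 1)))) with (1 / 2 + / t) in HL
      by (field; lra).
    assert (0 < / t) by (apply Rinv_0_lt_compat; lra).
    (* [HML] absorbs [ln t / 2], leaving at most [1 / 2 - / t]; dropping [- / t] costs nothing
       here. *)
    enough (0 <= 12 / 48 + 7 * t / 48 + 5 / (48 * t) - 1 / 2) by lra.
    replace (12 / 48 + 7 * t / 48 + 5 / (48 * t) - 1 / 2)
      with ((7 * t - 5) * (t - 1) / (48 * t)) by (field; lra).
    apply Rdiv_le_0_compat; nra.
Qed.

Theorem proposition3 (a b : R) (ha : 0 < a) (hab : a < b) :
  Rabs (- ln (identric_mean a b)
        + ln (Rpower a b / Rpower b a) / (2 * (b - a))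
        + 1 / 2 * ln (arith_mean a b))
  <= 12 / 48 + 7 * b / (48 * a) + 5 * a / (48 * b).
Proof.
  assert (ht : 1 < b / a) by (apply Rlt_div_r; lra).
  pose proof (reduced_bounds (b / a) ht) as H.
  assert (Hpos : forall x y, 0 < Rpower x y) by (intros; apply exp_pos).
  assert (HI : ln (identric_mean a b) = -1 + (b * ln b - a * ln a) / (b - a)).
  { unfold identric_mean. pose proof (exp_pos 1).
    rewrite ln_mult, ln_Rinv, ln_exp by (try apply Rinv_0_lt_compat; auto).
    unfold Rpower at 1. rewrite ln_exp, ln_div by auto.
    unfold Rpower. rewrite !ln_exp. field. lra. }
  assert (HQ : ln (Rpower a b / Rpower b a) = b * ln a - a * ln b).
  { rewrite ln_div by auto. unfold Rpower. now rewrite !ln_exp. }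
  assert (HA : ln (arith_mean a b) = ln a + ln ((1 + b / a) / 2)).
  { unfold arith_mean. rewrite <- ln_mult by lra. f_equal. field. lra. }
  rewrite ln_div in H by lra.
  rewrite HI, HQ, HA.
  replace (12 / 48 + 7 * b / (48 * a) + 5 * a / (48 * b))
    with (12 / 48 + 7 * (b / a) / 48 + 5 / (48 * (b / a))) by (field; lra).
  (* Homogeneity: the three summands contain [ln a] with weights -1, 1/2 and 1/2, which cancel, so
     both absolute values have the same argument. *)
  eapply Rle_trans; [right | exact H].
  f_equal. field. lra.
Qed.
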